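(* For all parameters $a,b,c,g$, the Dotsenko–Fateev operator $DF(a,b,c,g)$ is equal to the operator $E_3(e_1,\dots,e_7)$ whose exponents are those of the Riemann scheme of $DF(a,b,c,g)$, namely $$e_1=a+c+1,\quad e_2=2a+2c+g+2,\quad e_3=b+c+1,\quad e_4=2b+2c+g+2,$$ $$e_5=-2c,\quad e_6=-a-b-2c-g-1,\quad e_7=-2a-2b-2c-g-2 .$$
   Context: Let $\partial=d/dx$. The operator $E_3(e)$: for $e=(e_1,\dots,e_7)$ with $e_1+\cdots+e_7=3$, put $$E_3(e)=x^2(x-1)^2\partial^3+x(x-1)(a_{21}x+a_{20})\partial^2+(a_{12}x^2+a_{11}x+a_{10})\partial+a_{01}x+A_{00}(e),$$ where $a_{21}=6-e_1-e_2-e_3-e_4$, $a_{20}=-3+e_1+e_2$, $a_{12}=(e_5+e_6+1)e_7+(e_6+1)(e_5+1)$, $a_{11}=-(e_5+e_6)e_7-e_1e_2+e_3e_4-e_5e_6+2e_1+2e_2-4$, $a_{10}=(e_1-1)(e_2-1)$, $a_{01}=e_5e_6e_7$, and $$\begin{aligned}54A_{00}(e)=&-4(e_1+e_2-e_3-e_4)^3-27e_5e_6e_7+9(e_1+e_2-e_3-e_4)(e_5e_6+e_5e_7+e_6e_7-2)\\&+9e_1e_2(e_1+e_2-1)+18(e_1+e_2-1)(e_3^2+e_3e_4+e_4^2)\\&-9e_3e_4(e_3+e_4-1)-18(e_3+e_4-1)(e_1^2+e_1e_2+e_2^2).\end{aligned}$$ It is Fuchsian with local exponents $0,e_1,e_2$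 at $x=0$; $0,e_3,e_4$ at $x=1$; $e_5,e_6,e_7$ at $x=\infty$. The Dotsenko–Fateev operator is $$DF(a,b,c,g)=x^2(x-1)^2\partial^3+F_1\partial^2+F_2\partial+F_3,$$ where $$F_1=-(x-1)x(3ax+3bx+6cx+2gx-3a-3c-g),$$ $$\begin{aligned}F_2=&(2a^2+4ab+12ac+3ag+2b^2+12bc+3bg+12c^2+8cg+g^2+a+b+6c+g)x^2\\&-(4a^2+4ab+16ac+4ag+8bc+2bg+12c^2+8cg+g^2+2a+6c+g)x\\&+2a^2+4ac+ag+2c^2+cg+a+c,\end{aligned}$$ $$F_3=c(2a+2b+2c+g+2)\bigl(-(2a+2b+4c+2g+2)x+2a+2c+g+1\bigr).$$ *)

(* Defs.v *)
From mathcomp Require Import all_boot all_algebra.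

Set Implicit Arguments.
Unset Strict Implicit.
Unset Printing Implicit Defensive.

Import GRing.Theory.
Local Open Scope ring_scope.

(* A differential operator \sum_i p_i(x) \partial^i with polynomial           *)
(* coefficients is stored in its unique normal form (functions to the left of *)
(* \partial), as the element \sum_i p_i *: \partial^i of {poly {poly K}}.     *)
(* Pitfall: the ring product of {poly {poly K}} is commutative, hence is not  *)
(* the composition of operators; only sums and left multiplications           *)
(* p *: \partial^i by functions are meaningful here.                          *)
Definition diffop (K : fieldType) := {poly {poly K}}.

Definition dx {K : fieldType} (i : nat) : diffop K := 'X^i.

Definition diffop_apply (K : fieldType) (L : diffop K) (f : {poly K}) :
    {poly K} :=
  \sum_(i < size L) L`_i * f^`(i).

(* In characteristic 0, normal forms are equal as soon as they act equally on *)
(* polynomials, so equality in diffop K is equality of operators.             *)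
Lemma diffop_apply_inj (K : fieldType) (charK : [pchar K] =i pred0)
    (L M : diffop K) : diffop_apply L =1 diffop_apply M -> L = M.
Proof.
move=> eqLM.
have wide (D : diffop K) (n : nat) f : (size D <= n)%N ->
    diffop_apply D f = \sum_(i < n) D`_i * f^`(i).
  move=> leDn; rewrite /diffop_apply (big_ord_widen n (fun i => D`_i * f^`(i))) //.
  rewrite big_mkcond; apply: eq_bigr => i _; case: ltnP => // leDi.
  by rewrite nth_default ?mul0r.
pose n i := maxn i.+1 (maxn (size L) (size M)).
apply/polyP => i; elim/ltn_ind: i => i IH.
have tri (D : diffop K) : (size D <= n i)%N ->
    diffop_apply D 'X^i =
    D`_i *+ i`! + \sum_(j < n i | (j < i)%N) D`_j * ('X^i)^`(j).
  have lti : (i < n i)%N by rewrite leq_max leqnn.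
  move=> leD; rewrite (wide D (n i)) // (bigD1 (Ordinal lti)) //=; congr (_ + _).
    by rewrite derivnXn subnn expr0 ffactnn mulr_natr.
  rewrite big_mkcond [RHS]big_mkcond; apply: eq_bigr => j _.
  rewrite -val_eqE /= neq_ltn; case: ltngtP => //= ltij.
  by rewrite derivnXn ffact_small // mulr0n mulr0.
have := eqLM 'X^i; rewrite (tri L) ?(tri M) ?leq_max ?leqnn ?orbT //.
rewrite (eq_bigr (fun j : 'I_(n i) => M`_j * ('X^i)^`(j))) => [|j /IH -> //].
move: (L`_i) (M`_i) (\sum_(j < _ | _) _) => p q r /(@addIr {poly K} r).
rewrite -(mulr_natr p) -(mulr_natr q); apply: (@mulIf {poly K}).
by rewrite -polyC_natr polyC_eq0 ((pcharf0P K).1 charK) -lt0n fact_gt0.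
Qed.

Section Exponents.
Variable K : fieldType.
Implicit Types (L : diffop K) (s : K).

Definition low_coef (R : nzRingType) (p : {poly R}) : R :=
  p`_(find (predC1 0) p).

Definition falling (q : {poly K}) (i : nat) : {poly K} :=
  \prod_(j < i) (q - j%:R).

(* t^(n - rho) L(t^rho), with t = x - s and n the order of L, as a polynomial *)
(* in t (outer variable) with coefficients polynomial in rho (inner variable).*)
Definition frobenius_at s L : {poly {poly K}} :=
  \sum_(i < size L)
    (L`_i \Po ('X + s%:P))^:P * 'X^((size L).-1 - i) * (falling 'X i)%:P.

(* x^(n + rho) L(x^(- rho)), as a polynomial in x (outer variable) with       *)
(* coefficients polynomial in rho (inner variable).                           *)
Definition frobenius_infty L : {poly {poly K}} :=
  \sum_(i < size L)
    (L`_i)^:P * 'X^((size L).-1 - i) * (falling (- 'X) i)%:P.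

(* The indicial polynomial, in rho, is the coefficient of the dominant term   *)
(* as x tends to the point.                                                   *)
Definition indicial_at s L : {poly K} := low_coef (frobenius_at s L).
Definition indicial_infty L : {poly K} := lead_coef (frobenius_infty L).

(* rs lists the roots of the indicial polynomial with multiplicity; that      *)
(* there are as many as the order of L is Fuchs' criterion for the point to   *)
(* be (at most) a regular singularity.                                        *)
Definition exponents_of L (ind : {poly K}) (rs : seq K) : Prop :=
  size rs = (size L).-1 /\
  exists2 c : K, c != 0 & ind = c *: \prod_(r <- rs) ('X - r%:P).

(* L is Fuchsian, all its finite points outside unzip1 fin are ordinary, and  *)
(* the exponents are those listed in fin (finite points) and inf (infinity).  *)
Definition riemann_scheme L (fin : seq (K * seq K)) (inf : seq K) : Prop :=
  [/\ forall s, s \notin unzip1 fin -> ~~ root (lead_coef L) s,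
      forall s rs, (s, rs) \in fin -> exponents_of L (indicial_at s L) rs
    & exponents_of L (indicial_infty L) inf].

End Exponents.

Section Operators.
Variable K : fieldType.

Definition A00 (e1 e2 e3 e4 e5 e6 e7 : K) : K :=
  (- 4%:R * (e1 + e2 - e3 - e4) ^+ 3 - 27%:R * e5 * e6 * e7
   + 9%:R * (e1 + e2 - e3 - e4) * (e5 * e6 + e5 * e7 + e6 * e7 - 2%:R)
   + 9%:R * e1 * e2 * (e1 + e2 - 1)
   + 18%:R * (e1 + e2 - 1) * (e3 ^+ 2 + e3 * e4 + e4 ^+ 2)
   - 9%:R * e3 * e4 * (e3 + e4 - 1)
   - 18%:R * (e3 + e4 - 1) * (e1 ^+ 2 + e1 * e2 + e2 ^+ 2)) / 54%:R.

Definition E3 (e1 e2 e3 e4 e5 e6 e7 : K) : diffop K :=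
  let a21 := 6%:R - e1 - e2 - e3 - e4 in
  let a20 := - 3%:R + e1 + e2 in
  let a12 := (e5 + e6 + 1) * e7 + (e6 + 1) * (e5 + 1) in
  let a11 := - (e5 + e6) * e7 - e1 * e2 + e3 * e4 - e5 * e6
             + 2%:R * e1 + 2%:R * e2 - 4%:R in
  let a10 := (e1 - 1) * (e2 - 1) in
  let a01 := e5 * e6 * e7 in
  let x : {poly K} := 'X in
    (x ^+ 2 * (x - 1) ^+ 2) *: dx 3
  + (x * (x - 1) * (a21%:P * x + a20%:P)) *: dx 2
  + (a12%:P * x ^+ 2 + a11%:P * x + a10%:P) *: dx 1
  + (a01%:P * x + (A00 e1 e2 e3 e4 e5 e6 e7)%:P) *: dx 0.

Definition DF (a b c g : K) : diffop K :=
  let x : {poly K} := 'X in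
  let F1 :=
    - (x - 1) * x *
      ((3%:R * a + 3%:R * b + 6%:R * c + 2%:R * g)%:P * x
       - (3%:R * a + 3%:R * c + g)%:P) in
  let F2 :=
    (2%:R * a ^+ 2 + 4%:R * a * b + 12%:R * a * c + 3%:R * a * g
     + 2%:R * b ^+ 2 + 12%:R * b * c + 3%:R * b * g + 12%:R * c ^+ 2
     + 8%:R * c * g + g ^+ 2 + a + b + 6%:R * c + g)%:P * x ^+ 2
    - (4%:R * a ^+ 2 + 4%:R * a * b + 16%:R * a * c + 4%:R * a * g
       + 8%:R * b * c + 2%:R * b * g + 12%:R * c ^+ 2 + 8%:R * c * g
       + g ^+ 2 + 2%:R * a + 6%:R * c + g)%:P * x
    + (2%:R * a ^+ 2 + 4%:R * a * c + a * g + 2%:R * c ^+ 2 + c * g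
       + a + c)%:P in
  let F3 :=
    (c * (2%:R * a + 2%:R * b + 2%:R * c + g + 2%:R))%:P *
      (- (2%:R * a + 2%:R * b + 4%:R * c + 2%:R * g + 2%:R)%:P * x
       + (2%:R * a + 2%:R * c + g + 1)%:P) in
  (x ^+ 2 * (x - 1) ^+ 2) *: dx 3 + F1 *: dx 2 + F2 *: dx 1 + F3 *: dx 0.

End Operators.

(* Main.v *)
(* The equality with E3 compares coefficients of each \partial^i;             *)
(* characteristic 0 serves only to divide by 54 in A00. The Riemann scheme    *)
(* holds for every E3(e) with e1 + ... + e7 = 3: only the extreme terms of    *)
(* the coefficients of L enter the indicial polynomials, which are            *)
(* rho(rho-e1)(rho-e2) at 0, rho(rho-e3)(rho-e4) at 1 (by the Fuchs relation) *)
(* and -(rho-e5)(rho-e6)(rho-e7) at infinity.                                 *)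

Require Import Defs.
From mathcomp Require Import all_boot all_algebra.
From mathcomp Require Import ring.

Import GRing.Theory.
Local Open Scope ring_scope.

(** Every coefficient of [E3] except the constant [A00] is dictated by the exponents: those at 0 and
    1 are read off the lowest terms there ([exponents_at_diffop3]), those at infinity off the top
    terms ([exponents_infty_diffop3]). This gives [riemann_scheme_E3]. The remaining constant [A00]
    is the accessory parameter; at the given exponents its cubic factors as the constant term of
    [DF]. The other coefficients agree by expansion, so the scheme passes to [DF]. *)

Lemma low_coefXnM (R : nzRingType) (n : nat) (q : {poly R}) :
  q`_0 != 0 -> low_coef ('X^n * q) = q`_0.
Proof.
move=> q0; rewrite /low_coef; set p : {poly R} := 'X^n * q.
have pn : p`_n = q`_0 by rewrite coefXnM ltnn subnn.
suff -> : find (predC1 0) p = n by [].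
have lt_n : (n < size p)%N.
  by rewrite ltnNge; apply: contra q0 => /(nth_default 0); rewrite -pn => ->.
have le_find : (find (predC1 0%R) p <= n)%N.
  by rewrite leqNgt; apply/negP => /(before_find 0) /=; rewrite pn q0.
apply/eqP; rewrite eqn_leq le_find leqNgt; apply/negP => lt_find.
have /(nth_find 0) /= : has (predC1 0) p by rewrite has_find (ltn_trans lt_find).
by rewrite [p`__]coefXnM lt_find eqxx.
Qed.

Lemma lead_coef_quadratic (R : nzRingType) (u v w : R) :
  u != 0 -> lead_coef (u%:P * 'X^2 + v%:P * 'X + w%:P) = u.
Proof.
move=> u0; have -> : u%:P * 'X^2 + v%:P * 'X + w%:P = Poly [:: w; v; u].
  by rewrite /= !cons_poly_def mul0r add0r expr2 mulrDl mulrA.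
by rewrite /lead_coef (PolyK (c := 0)).
Qed.

Section ThirdOrder.
Variable K : fieldType.

Definition diffop3 (p3 p2 p1 p0 : {poly K}) : diffop K :=
  p3 *: dx 3 + p2 *: dx 2 + p1 *: dx 1 + p0 *: dx 0.

Variables p3 p2 p1 p0 : {poly K}.
Hypothesis p3_neq0 : p3 != 0.
Let L := diffop3 p3 p2 p1 p0.

(** As [p3] is nonzero, the order is exactly 3, so sums over [size L] unfold to four terms. *)
Lemma polyseq_diffop3 : L = [:: p0; p1; p2; p3] :> seq _.
Proof.
suff -> : L = Poly [:: p0; p1; p2; p3] by rewrite (PolyK (c := 0)).
apply/polyP => i; rewrite coef_Poly /L /diffop3 /dx !coefD !coefZ !coefXn.
by case: i => [|[|[|[|i]]]];
  rewrite /= ?nth_nil ?mulr0 ?mulr1 ?addr0 ?add0r.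
Qed.

Lemma lead_coef_diffop3 : lead_coef L = p3.
Proof. by rewrite /lead_coef polyseq_diffop3. Qed.

Lemma frobenius_at_diffop3 (s : K) :
  let sh p := (p \Po ('X + s%:P))^:P in
  frobenius_at s L = sh p3 * ('X * ('X - 1) * ('X - 2%:R))%:P
    + sh p2 * 'X * ('X * ('X - 1))%:P + sh p1 * 'X^2 * ('X)%:P + sh p0 * 'X^3.
Proof.
rewrite /frobenius_at polyseq_diffop3 /= !big_ord_recr big_ord0 /= /falling.
rewrite !big_ord_recr !big_ord0 /=; ring.
Qed.

Lemma frobenius_infty_diffop3 :
  frobenius_infty L = p3^:P * (- 'X * (- 'X - 1) * (- 'X - 2%:R))%:P
    + p2^:P * 'X * (- 'X * (- 'X - 1))%:P + p1^:P * 'X^2 * (- 'X)%:P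
    + p0^:P * 'X^3.
Proof.
rewrite /frobenius_infty polyseq_diffop3 /= !big_ord_recr big_ord0 /= /falling.
rewrite !big_ord_recr !big_ord0 /=; ring.
Qed.

(** With t = x - s, the factor t^2 comes out of the Frobenius polynomial and the cofactor at t = 0
    is rho(rho-1)(rho-2) + (3-r1-r2) rho(rho-1) + (r1-1)(r2-1) rho = rho(rho-r1)(rho-r2). *)
Lemma exponents_at_diffop3 (s r1 r2 : K) (q3 q2 q1 : {poly K}) :
    p3 \Po ('X + s%:P) = 'X^2 * q3 -> p2 \Po ('X + s%:P) = 'X * q2 ->
    p1 \Po ('X + s%:P) = q1 -> q3.[0] = 1 ->
    q2.[0] = 3%:R - r1 - r2 -> q1.[0] = (r1 - 1) * (r2 - 1) ->
  exponents_of L (indicial_at s L) [:: 0; r1; r2].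
Proof.
move=> p3E p2E p1E q3_0 q2_0 q1_0; split; first by rewrite polyseq_diffop3.
exists 1; first exact: oner_neq0.
rewrite scale1r /indicial_at frobenius_at_diffop3 p3E p2E p1E.
set p := \prod_(_ <- _) _; set q : {poly {poly K}} :=
  q3^:P * ('X * ('X - 1) * ('X - 2%:R))%:P + q2^:P * ('X * ('X - 1))%:P
  + q1^:P * ('X)%:P + (p0 \Po ('X + s%:P))^:P * 'X.
have q0 : q`_0 = p.
  rewrite -horner_coef0 !(hornerD, hornerM, hornerC, hornerX) -polyC0.
  rewrite !horner_map /= q3_0 q2_0 q1_0.
  by rewrite /p !big_cons big_nil /=; ring.
rewrite -q0 -(low_coefXnM _ 2) ?q0 ?monic_neq0 ?monic_prod_XsubC //.
by congr low_coef; rewrite /q !rmorphM /= !map_polyX; ring.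
Qed.

Lemma exponents_infty_diffop3 (r1 r2 r3 a21 a20 a12 a11 a10 a01 a00 : K) :
    p3 = 'X^2 * ('X - 1) ^+ 2 -> p2 = 'X * ('X - 1) * (a21%:P * 'X + a20%:P) ->
    p1 = a12%:P * 'X^2 + a11%:P * 'X + a10%:P -> p0 = a01%:P * 'X + a00%:P ->
    a21 = 3%:R + r1 + r2 + r3 ->
    a12 = 1 + r1 + r2 + r3 + r1 * r2 + r1 * r3 + r2 * r3 ->
    a01 = r1 * r2 * r3 ->
  exponents_of L (indicial_infty L) [:: r1; r2; r3].
Proof.
move=> p3E p2E p1E p0E a21E a12E a01E; split; first by rewrite polyseq_diffop3.
(* The sign comes from the top term -rho^3 of (-rho)(-rho-1)(-rho-2). *)
exists (- 1); first by rewrite oppr_eq0 oner_neq0.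
rewrite /indicial_infty frobenius_infty_diffop3 p3E p2E p1E p0E.
set u := _ *: _.
have u_neq0 : u != 0.
  by rewrite scaler_eq0 oppr_eq0 oner_eq0 monic_neq0 ?monic_prod_XsubC.
pose f3 : {poly K} := - 'X * (- 'X - 1) * (- 'X - 2%:R).
pose f2 : {poly K} := - 'X * (- 'X - 1).
have uE : u = f3 + a21%:P * f2 - a12%:P * 'X + a01%:P.
  rewrite /u /f3 /f2 !big_cons big_nil a21E a12E a01E scaleN1r; ring.
(* The Frobenius polynomial is x^2 (u x^2 + v x + w), so [u] is its leading coefficient. *)
set v := - 2%:R * f3 + (a20%:P - a21%:P) * f2 - a11%:P * 'X + a00%:P.
set w := f3 - a20%:P * f2 - a10%:P * 'X.
rewrite -[RHS](lead_coef_quadratic _ u v w u_neq0).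
rewrite -[RHS](lead_coef_monicM _ (monicXn _ 2)).
rewrite uE /v /w /f3 /f2; congr lead_coef.
rewrite !(rmorphM, rmorphD, rmorphN, rmorph1) /= !map_polyX !map_polyC /=; ring.
Qed.

End ThirdOrder.

Lemma riemann_scheme_E3 (K : fieldType) (e1 e2 e3 e4 e5 e6 e7 : K) :
    e1 + e2 + e3 + e4 + e5 + e6 + e7 = 3%:R ->
  riemann_scheme (E3 e1 e2 e3 e4 e5 e6 e7)
    [:: (0, [:: 0; e1; e2]); (1, [:: 0; e3; e4])] [:: e5; e6; e7].
Proof.
(* The Fuchs relation yields a12 + a11 + a10 = (e3-1)(e4-1) at 1 and a21 = 3 + e5 + e6 + e7 at
   infinity. *)
move=> sum_e; have {sum_e} e4E : e4 = 3%:R - e1 - e2 - e3 - e5 - e6 - e7.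
  by rewrite -sum_e; ring.
have p3_neq0 : 'X^2 * ('X - 1) ^+ 2 != 0 :> {poly K}.
  by rewrite mulf_neq0 // expf_neq0 // ?polyX_eq0 // -polyC1 polyXsubC_eq0.
rewrite /E3; set a21 := 6%:R - _ - _ - _ - _; set a20 := - 3%:R + _ + _.
set a12 := _ + (e6 + 1) * _; set a11 := _ - 4%:R; set a10 := (e1 - 1) * _.
set p2 := _ * (a21%:P * _ + _); set p1 := _ + a10%:P.
split=> [s | s rs |].
- rewrite lead_coef_diffop3 //= !inE negb_or => /andP[s0 s1].
  by rewrite /root !hornerE !mulf_neq0 // subr_eq0.
- rewrite !inE => /orP[] /eqP[-> ->].
  + apply: (exponents_at_diffop3 _ _ _ _ _ p3_neq0 _ _ _ (('X - 1) ^+ 2)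
      (('X - 1) * (a21%:P * 'X + a20%:P)) p1);
      rewrite ?polyC0 ?addr0 ?comp_polyXr ?mulrA //.
    * rewrite !hornerE; ring.
    * rewrite !hornerE /= /a20; ring.
    * rewrite /p1 !hornerE /= /a10; ring.
  (* In t = x - 1 the factors x and x - 1 become t + 1 and t. *)
  + apply: (exponents_at_diffop3 _ _ _ _ _ p3_neq0 _ _ _ (('X + 1) ^+ 2)
      (('X + 1) * (a21%:P * ('X + 1) + a20%:P)) (p1 \Po ('X + 1%:P))) => //.
    * rewrite !(rmorphM, rmorphB) /= comp_polyX rmorph1; ring.
    * rewrite !(rmorphM, rmorphB, rmorphD) /= comp_polyX !comp_polyC rmorph1.
      ring.
    * rewrite !hornerE; ring.
    * rewrite !hornerE /= /a21 /a20; ring.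
    * rewrite horner_comp !hornerE /= /a12 /a11 /a10 e4E; ring.
- apply: (exponents_infty_diffop3 _ _ _ _ _ p3_neq0
    _ _ _ a21 a20 a12 a11 a10) => //.
  + rewrite /a21 e4E; ring.
  + rewrite /a12; ring.
Qed.

Theorem theorem2p1 (K : fieldType) (charK : [pchar K] =i pred0)
    (a b c g : K) :
  let e1 := a + c + 1 in
  let e2 := 2%:R * a + 2%:R * c + g + 2%:R in
  let e3 := b + c + 1 in
  let e4 := 2%:R * b + 2%:R * c + g + 2%:R in
  let e5 := - (2%:R * c) in
  let e6 := - a - b - 2%:R * c - g - 1 in
  let e7 := - (2%:R * a) - 2%:R * b - 2%:R * c - g - 2%:R in
  [/\ e1 + e2 + e3 + e4 + e5 + e6 + e7 = 3%:R,
      riemann_scheme (DF a b c g)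
        [:: (0, [:: 0; e1; e2]); (1, [:: 0; e3; e4])] [:: e5; e6; e7]
    & DF a b c g = E3 e1 e2 e3 e4 e5 e6 e7].
Proof.
move=> e1 e2 e3 e4 e5 e6 e7.
have sum_e : e1 + e2 + e3 + e4 + e5 + e6 + e7 = 3%:R.
  by rewrite /e1 /e2 /e3 /e4 /e5 /e6 /e7; ring.
suff DFE : DF a b c g = E3 e1 e2 e3 e4 e5 e6 e7.
  by split=> //; rewrite DFE; exact: riemann_scheme_E3.
have n54 : 54%:R != 0 :> K by rewrite ((pcharf0P K).1 charK).
have A00E : A00 e1 e2 e3 e4 e5 e6 e7 =
    c * (2%:R * a + 2%:R * b + 2%:R * c + g + 2%:R)
      * (2%:R * a + 2%:R * c + g + 1).
  (* Clearing the denominator 54 leaves a polynomial identity in [a], [b], [c], [g]. *)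
  apply: (mulIf n54); rewrite /A00 divfK //.
  by rewrite /e1 /e2 /e3 /e4 /e5 /e6 /e7; ring.
rewrite /DF /E3 A00E; congr (_ + _ *: _ + _ *: _ + _ *: _).
all: rewrite /e1 /e2 /e3 /e4 /e5 /e6 /e7; ring.
Qed.
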